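(* Let $\Phi$ be a shrinking derivation in system $lo$ of $\Gamma\vdash^{(b,r)}t:\tau$, where $t$ is a $\lambda$-term and $\tau$ a type. Then there exist a $\to_{lo}$-normal form $p$ and a natural number $k\le b/2$ such that: (1) $t\to_{lo}^k p$; (2) $|p|_{lo}\le|\Phi|_{lo}-2k$. Moreover, if $\Phi$ is traditional then $|p|_{lo}\le|\Phi|_{ty}$.
   Context: Terms are $\lambda$-terms $t,p,u,q::=x\mid\lambda x.t\mid t\,p$, up to $\alpha$-equivalence; $t\{x\leftarrow p\}$ is capture-avoiding substitution. Leftmost-outermost predicates (inductive): $\mathrm{neutral}_{lo}(x)$; $\mathrm{neutral}_{lo}(t\,p)$ if $\mathrm{neutral}_{lo}(t)$ and $\mathrm{normal}_{lo}(p)$; $\mathrm{normal}_{lo}(t)$ if $\mathrm{neutral}_{lo}(t)$; $\mathrm{normal}_{lo}(\lambda y.t)$ if $\mathrm{normal}_{lo}(t)$. Strategy $\to_{lo}$ (inductive): $(\lambda x.u)q\to_{lo}u\{x\leftarrow q\}$; $\lambda x.t\to_{lo}\lambda x.p$ if $t\to_{lo}p$; $t\,u\to_{lo}p\,u$ if $t\to_{lo}p$ and $t$ is not an abstraction; $u\,t\to_{lo}u\,p$ if $\mathrm{neutral}_{lo}(u)$ and $t\to_{lo}p$. $\to_{lo}^k$ is $k$-fold iteration. Size: $|x|_{lo}=0$, $|\lambda x.p|_{lo}=|p|_{lo}+1$, $|p\,u|_{lo}=|p|_{lo}+|u|_{lo}+1$. Types: tight constants are $\mathtt{neutral}$ and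 $\mathtt{abs}$ (generically $\mathtt{tight}$); types $\tau,\sigma::=\mathtt{tight}\mid X\mid M\to\tau$, with $X$ in a non-empty set of atomic types; $M::=[\tau_i]_{i\in I}$ ($I$ finite) are finite multisets, $[\,]$ the empty one. A multiset is tight if all its elements are tight constants. A typing context $\Gamma$ maps variables to multisets, all but finitely many to $[\,]$. $\uplus$ is multiset union, pointwise on contexts. $\Gamma\setminus\!\!\setminus x$ is $\Gamma$ with $x$ reset to $[\,]$. Typing rules of system $lo$: (ax) $x:[\tau]\vdash^{(0,0)}x:\tau$. (fun$_b$) from $\Gamma\vdash^{(b,r)}t:\tau$ infer $\Gamma\setminus\!\!\setminus x\vdash^{(b+1,r)}\lambda x.t:\Gamma(x)\to\tau$. (fun$_r$) from $\Gamma\vdash^{(b,r)}t:\mathtt{tight}$ with $\Gamma(x)$ tight infer $\Gamma\setminus\!\!\setminus x\vdash^{(b,r+1)}\lambda x.t:\mathtt{abs}$. (app$_b$) from $\Gamma\vdash^{(b,r)}t:M\to\tau$ and $\Delta\vdash^{(b',r')}p:M$ infer $\Gamma\uplus\Delta\vdash^{(b+b'+1,r+r')}t\,p:\tau$. (app$_r$) from $\Gamma\vdash^{(b,r)}t:\mathtt{neutral}$ and $\Delta\vdash^{(b',r')}p:\mathtt{tight}$ infer $\Gamma\uplus\Delta\vdash^{(b+b',r+r'+1)}t\,p:\mathtt{neutral}$. (many) from $(\Delta_i\vdash^{(b_i,r_i)}t:\tau_i)_{i\in I}$, $I$ finite, possibly empty, infer $\uplus_{i}\Delta_i\vdash^{(\sum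 b_i,\sum r_i)}t:[\tau_i]_{i\in I}$. $|\Phi|_{lo}$ is the number of rule instances in $\Phi$ other than (ax) and (many). Positive and negative occurrences ($T$ ranges over types and multisets), by mutual induction: $\tau\in\mathrm{Occ}_+(\tau)$; $M\in\mathrm{Occ}_+(M)$; for $s\in\{+,-\}$, $T\in\mathrm{Occ}_s(M)$ if $T\in\mathrm{Occ}_s(\sigma)$ for some $\sigma\in M$; $T\in\mathrm{Occ}_+(M\to\tau)$ if $T\in\mathrm{Occ}_-(M)$ or $T\in\mathrm{Occ}_+(\tau)$; $T\in\mathrm{Occ}_-(M\to\tau)$ if $T\in\mathrm{Occ}_+(M)$ or $T\in\mathrm{Occ}_-(\tau)$; $T\in\mathrm{Occ}_s(x:M,\Gamma)$ if $T\in\mathrm{Occ}_s(M)$ or $T\in\mathrm{Occ}_s(\Gamma)$. A derivation of $\Gamma\vdash^{(b,r)}t:\tau$ is shrinking if $[\,]\notin\mathrm{Occ}_-(\Gamma)$ and $[\,]\notin\mathrm{Occ}_+(\tau)$. It is traditional if no type occurring in it is a tight constant (so rules (fun$_r$), (app$_r$) do not occur). Type size: $|X|_{ty}=|\mathtt{tight}|_{ty}=0$; $|M|_{ty}=\sum_{\tau\in M}|\tau|_{ty}$; $|M\to\tau|_{ty}=|M|_{ty}+|\tau|_{ty}+1$; $|\Gamma|_{ty}=\sum_x|\Gamma(x)|_{ty}$; for a derivation $\Phi$ of $\Gamma\vdash^{(b,r)}t:\tau$, $|\Phi|_{ty}=|\Gamma|_{ty}+|\tau|_{ty}$. *)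

(* Defs.v *)
From HB Require Import structures.
From mathcomp Require Import all_boot finmap multiset.

Set Implicit Arguments.
Unset Strict Implicit.
Unset Printing Implicit Defensive.

Local Open Scope fset_scope.
Local Open Scope fmap_scope.
Local Open Scope mset_scope.
Local Open Scope nat_scope.

(* Terms up to alpha-equivalence are represented with de Bruijn indices. *)
Inductive term : Type :=
| Var of nat
| Lam of term
| App of term & term.

Fixpoint lift (c : nat) (t : term) : term :=
  match t with
  | Var n => Var (if n < c then n else n.+1)
  | Lam u => Lam (lift c.+1 u)
  | App u v => App (lift c u) (lift c v)
  end.

(* [subst k p t] replaces index [k] by [p] and removes the corresponding binder:
   the indices above [k] are decremented.  Thus [subst 0 p t] is t{x <- p}
   when [t] is the body of a lambda binding x. *)
Fixpoint subst (k : nat) (p t : term) : term :=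
  match t with
  | Var n => if n < k then Var n else if n == k then p else Var n.-1
  | Lam u => Lam (subst k.+1 (lift 0 p) u)
  | App u v => App (subst k p u) (subst k p v)
  end.

Definition is_abstraction (t : term) : bool :=
  if t is Lam _ then true else false.

Inductive neutral_lo : term -> Prop :=
| neutral_lo_var n : neutral_lo (Var n)
| neutral_lo_app t p : neutral_lo t -> normal_lo p -> neutral_lo (App t p)
with normal_lo : term -> Prop :=
| normal_lo_neutral t : neutral_lo t -> normal_lo t
| normal_lo_lam t : normal_lo t -> normal_lo (Lam t).

Inductive lo_step : term -> term -> Prop :=
| lo_beta u q : lo_step (App (Lam u) q) (subst 0 q u)
| lo_lam t p : lo_step t p -> lo_step (Lam t) (Lam p)
| lo_appl t p u :
    lo_step t p -> ~~ is_abstraction t -> lo_step (App t u) (App p u)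
| lo_appr u t p :
    neutral_lo u -> lo_step t p -> lo_step (App u t) (App u p).

Fixpoint lo_steps (k : nat) (t p : term) : Prop :=
  if k is k'.+1 then exists2 u, lo_step t u & lo_steps k' u p else t = p.

Definition lo_normal_form (p : term) : Prop := forall q, ~ lo_step p q.

Fixpoint term_size (t : term) : nat :=
  match t with
  | Var _ => 0
  | Lam p => (term_size p).+1
  | App p u => (term_size p + term_size u).+1
  end.

(* A type is a raw type (with sequences on the left of arrows) all of whose
   sequences are the canonical enumeration of the multiset of their elements.
   Leibniz equality on [ty A] is therefore equality of types whose arrows have
   genuine finite multisets as sources; see [ty_ind_arr] and [Arr_inj]. *)

Inductive tight_const : Type := TNeutral | TAbs.

Section Types.
Context {A : choiceType}.

Inductive raw : Type :=
| RTight of tight_const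
| RAtom of A
| RArr of seq raw & raw.

Fixpoint raw_ind_seq (P : raw -> Prop)
    (Pt : forall c, P (RTight c)) (Pa : forall x, P (RAtom x))
    (Pr : forall M a, foldr (fun b Q => P b /\ Q) True M -> P a -> P (RArr M a))
    (a : raw) : P a :=
  match a with
  | RTight c => Pt c
  | RAtom x => Pa x
  | RArr M b =>
    Pr M b ((fix go (N : seq raw) : foldr (fun b Q => P b /\ Q) True N :=
               if N is c :: N' then conj (raw_ind_seq Pt Pa Pr c) (go N')
               else I) M)
       (raw_ind_seq Pt Pa Pr b)
  end.

Fixpoint raw_enc (a : raw) : GenTree.tree (bool + A) :=
  match a with
  | RTight c => GenTree.Leaf (inl (if c is TNeutral then true else false))
  | RAtom x => GenTree.Leaf (inr x)
  | RArr M b => GenTree.Node 0 (raw_enc b :: map raw_enc M)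
  end.

Fixpoint raw_dec (t : GenTree.tree (bool + A)) : raw :=
  match t with
  | GenTree.Leaf (inl b) => RTight (if b then TNeutral else TAbs)
  | GenTree.Leaf (inr x) => RAtom x
  | GenTree.Node _ [::] => RTight TNeutral
  | GenTree.Node _ (t :: ts) => RArr (map raw_dec ts) (raw_dec t)
  end.

Lemma raw_encK : cancel raw_enc raw_dec.
Proof.
elim/raw_ind_seq => [[]|x|M b IHM IHb] //=.
by rewrite IHb; congr RArr; elim: M IHM => //= c M IH [-> /IH ->].
Qed.

HB.instance Definition _ := Equality.copy raw (can_type raw_encK).
HB.instance Definition _ := Choice.copy raw (can_type raw_encK).

Fixpoint canonical (a : raw) : bool :=
  if a is RArr M b then
    [&& (seq_mset M : seq raw) == M, all canonical M & canonical b]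
  else true.

Fixpoint raw_size (a : raw) : nat :=
  if a is RArr M b then (sumn (map raw_size M) + raw_size b).+1 else 0.

Record ty : Type := Ty { raw_of :> raw; _ : canonical raw_of }.

HB.instance Definition _ := [isSub of ty for raw_of].
HB.instance Definition _ := [Choice of ty by <:].

Definition Tight (c : tight_const) : ty := @Ty (RTight c) isT.
Definition Atom (x : A) : ty := @Ty (RAtom x) isT.

Definition raw_arr (M : {mset ty}) (t : ty) : raw :=
  RArr (seq_mset [seq raw_of s | s <- M]) t.

Lemma raw_arr_canonical (M : {mset ty}) (t : ty) : canonical (raw_arr M t).
Proof.
rewrite /raw_arr /= seq_mset_id eqxx (valP t) andbT /=.
rewrite (perm_all _ (perm_eq_seq_mset _)) all_map.
by apply/allP => s _; apply: valP.
Qed.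

Definition Arr (M : {mset ty}) (t : ty) : ty := Ty (raw_arr_canonical M t).

Definition is_tight (t : ty) : bool := if raw_of t is RTight _ then true else false.

Definition mset_tight (M : {mset ty}) : bool := all is_tight M.

Definition ty_size (t : ty) : nat := raw_size t.
Definition mset_size (M : {mset ty}) : nat := \sum_(t <- M) ty_size t.

Lemma is_tightP (t : ty) : reflect (exists c, t = Tight c) (is_tight t).
Proof.
apply: (iffP idP) => [|[c ->] //].
by case: t => -[c|x|M b] //= h _; exists c; apply: val_inj.
Qed.

Lemma ty_size_tight c : ty_size (Tight c) = 0. Proof. by []. Qed.
Lemma ty_size_atom x : ty_size (Atom x) = 0. Proof. by []. Qed.
Lemma ty_size_arr M t : ty_size (Arr M t) = (mset_size M + ty_size t).+1.
Proof.
rewrite /ty_size /mset_size /= (perm_sumn (perm_map _ (perm_eq_seq_mset _))).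
by rewrite -map_comp sumn_map.
Qed.

Lemma Arr_inj M N t s : Arr M t = Arr N s -> M = N /\ t = s.
Proof.
move=> /(congr1 raw_of)[eMN ets]; split; last exact: val_inj.
have pMN : perm_eq (map raw_of M) (map raw_of N).
  have pM := perm_eq_seq_mset (map raw_of M).
  have pN := perm_eq_seq_mset (map raw_of N).
  by rewrite -(permPl pM) eMN (permPl pN).
have /eq_seq_msetP := perm_map_inj (@val_inj _ _ ty) pMN.
by rewrite !seq_mset_id.
Qed.

Lemma ty_ind_arr (P : ty -> Prop) :
    (forall c, P (Tight c)) -> (forall x, P (Atom x)) ->
    (forall M t, (forall s, s \in M -> P s) -> P t -> P (Arr M t)) ->
  forall t, P t.
Proof.
move=> Pt Pa Pr [a]; elim/raw_ind_seq: a => [c|x|M b IHM IHb] h.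
- by have := Pt c; congr P; apply: val_inj.
- by have := Pa x; congr P; apply: val_inj.
have /and3P[/eqP eM cM cb] := h.
have [L eL] : exists L : seq ty, map raw_of L = M.
  elim: M cM {IHM h eM} => [|c M IH] /= => [_|/andP[hc /IH[L <-]]].
    by exists [::].
  by exists (Ty hc :: L).
have -> : Ty h = Arr (seq_mset L) (Ty cb).
  apply: val_inj; rewrite /= /raw_arr /=; congr RArr.
  rewrite -{1}eM -eL; congr (enum_mset _); apply/eq_seq_msetP.
  by rewrite perm_sym; apply: perm_map; apply: perm_eq_seq_mset.
apply: Pr => [s|]; last exact: IHb.
rewrite (perm_mem (perm_eq_seq_mset L)) => sL.
have : raw_of s \in M by rewrite -eL map_f.
elim: M IHM {h eM cM eL} => //= c M IH [Pc /IH{}IH].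
rewrite inE => /predU1P[e|//]; case: s e {sL IH} => r hr /= e.
by move: hr; rewrite e; apply: Pc.
Qed.

Inductive polarity : Type := Pos | Neg.

Definition opp (s : polarity) : polarity := if s is Pos then Neg else Pos.

(* [occ_ty T s t] is T \in Occ_s(t) and [occ_mset T s M] is T \in Occ_s(M),
   where T is either a type ([inl]) or a multiset ([inr]). *)
Inductive occ_ty (T : ty + {mset ty}) : polarity -> ty -> Prop :=
| occ_ty_self t : T = inl t -> occ_ty T Pos t
| occ_ty_source s M t : occ_mset T (opp s) M -> occ_ty T s (Arr M t)
| occ_ty_target s M t : occ_ty T s t -> occ_ty T s (Arr M t)
with occ_mset (T : ty + {mset ty}) : polarity -> {mset ty} -> Prop :=
| occ_mset_self M : T = inr M -> occ_mset T Pos M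
| occ_mset_elt s M t : t \in M -> occ_ty T s t -> occ_mset T s M.

Definition ctx := {fsfun nat -> {mset ty} with mset0}.

Definition ctx0 : ctx := [fsfun].
Definition ctx1 (x : nat) (M : {mset ty}) : ctx := [fsfun ctx0 with x |-> M].

Definition ctxU (G D : ctx) : ctx :=
  [fsfun x in (finsupp G `|` finsupp D)%fset => G x `+` D x].

(* The context G \\ x when x is the variable bound by an abstraction: entry 0 is
   dropped, and the other variables are renumbered when leaving the binder. *)
Definition ctx_pop (G : ctx) : ctx :=
  [fsfun x in [fset y.-1 | y in finsupp G] => G x.+1].

Definition ctx_size (G : ctx) : nat := \sum_(x <- finsupp G) mset_size (G x).

Definition occ_ctx (T : ty + {mset ty}) (s : polarity) (G : ctx) : Prop :=
  exists x, occ_mset T s (G x).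

Lemma ctx0E x : ctx0 x = mset0.
Proof. by rewrite /ctx0 fsfun0E. Qed.

Lemma ctx1E x M y : ctx1 x M y = if y == x then M else mset0.
Proof. by rewrite /ctx1 fsfun_withE ctx0E. Qed.

Lemma ctxUE G D x : ctxU G D x = G x `+` D x.
Proof.
rewrite fsfun_fun in_fsetU; have [//|] := boolP (_ || _).
by rewrite negb_or => /andP[/fsfun_dflt-> /fsfun_dflt->]; rewrite msetD0.
Qed.

Lemma ctx_popE G x : ctx_pop G x = G x.+1.
Proof.
rewrite fsfun_fun; have [//|xG] := boolP (x \in _).
rewrite fsfun_dflt //; apply: contra xG => xG.
by apply/imfsetP; exists x.+1.
Qed.

(* [der G b r t s] is the type of derivations of G |-(b,r) t : s and
   [mder G b r t M] that of derivations of G |-(b,r) t : M ending with (many). *)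
Inductive der : ctx -> nat -> nat -> term -> ty -> Type :=
| der_ax x t : der (ctx1 x [mset t]) 0 0 (Var x) t
| der_fun_b G b r t s :
    der G b r t s ->
    der (ctx_pop G) b.+1 r (Lam t) (Arr (G 0) s)
| der_fun_r G b r t c :
    der G b r t (Tight c) -> mset_tight (G 0) ->
    der (ctx_pop G) b r.+1 (Lam t) (Tight TAbs)
| der_app_b G D b b' r r' t p M s :
    der G b r t (Arr M s) -> mder D b' r' p M ->
    der (ctxU G D) (b + b').+1 (r + r') (App t p) s
| der_app_r G D b b' r r' t p c :
    der G b r t (Tight TNeutral) -> der D b' r' p (Tight c) ->
    der (ctxU G D) (b + b') (r + r').+1 (App t p) (Tight TNeutral)
with mder : ctx -> nat -> nat -> term -> {mset ty} -> Type :=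
| der_many n (D : 'I_n -> ctx) (b r : 'I_n -> nat) t (s : 'I_n -> ty) :
    (forall i, der (D i) (b i) (r i) t (s i)) ->
    mder (\big[ctxU/ctx0]_(i < n) D i) (\sum_(i < n) b i) (\sum_(i < n) r i)
         t (seq_mset [seq s i | i : 'I_n]).

Fixpoint der_size_lo G b r t s (F : der G b r t s) : nat :=
  match F with
  | der_ax _ _ => 0
  | der_fun_b _ _ _ _ _ F1 => (der_size_lo F1).+1
  | der_fun_r _ _ _ _ _ F1 _ => (der_size_lo F1).+1
  | der_app_b _ _ _ _ _ _ _ _ _ _ F1 F2 =>
      (der_size_lo F1 + mder_size_lo F2).+1
  | der_app_r _ _ _ _ _ _ _ _ _ F1 F2 =>
      (der_size_lo F1 + der_size_lo F2).+1
  end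
with mder_size_lo G b r t M (F : mder G b r t M) : nat :=
  match F with
  | der_many n _ _ _ _ _ Fs => \sum_(i < n) der_size_lo (Fs i)
  end.

Definition der_size_ty G b r t s (F : der G b r t s) : nat :=
  ctx_size G + ty_size s.

Definition shrinking G b r t s (F : der G b r t s) : Prop :=
  ~ occ_ctx (inr mset0) Neg G /\ ~ occ_ty (inr mset0) Pos s.

(* No tight constant among the types occurring, at any depth, in the judgment
   with context [G] and assigned type [t] (resp. assigned multiset [M]). *)
Definition tight_free G (t : ty) : Prop :=
  forall c pol, ~ occ_ctx (inl (Tight c)) pol G /\ ~ occ_ty (inl (Tight c)) pol t.
Definition tight_free_mset G (M : {mset ty}) : Prop :=
  forall c pol,
    ~ occ_ctx (inl (Tight c)) pol G /\ ~ occ_mset (inl (Tight c)) pol M.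

Fixpoint traditional G b r t s (F : der G b r t s) : Prop :=
  tight_free G s /\
  match F with
  | der_ax _ _ => True
  | der_fun_b _ _ _ _ _ F1 => traditional F1
  | der_fun_r _ _ _ _ _ F1 _ => traditional F1
  | der_app_b _ _ _ _ _ _ _ _ _ _ F1 F2 => traditional F1 /\ mtraditional F2
  | der_app_r _ _ _ _ _ _ _ _ _ F1 F2 => traditional F1 /\ traditional F2
  end
with mtraditional G b r t M (F : mder G b r t M) : Prop :=
  tight_free_mset G M /\
  match F with
  | der_many n _ _ _ _ _ Fs => forall i, traditional (Fs i)
  end.

End Types.

Arguments raw A : clear implicits.
Arguments ty A : clear implicits.
Arguments ctx A : clear implicits.

(* Main.v *)
(* Quantitative subject reduction: a step of the strategy keeps the context, the
   type and [r], and consumes at least one abstraction and one application rule,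
   so [b] drops by at least 2.  A step inside an argument of a neutral term would
   leave the derivation unchanged if the argument were assigned the empty
   multiset; shrinking excludes this, because the type of a neutral term is a
   target of the type of its head variable, so that an empty source in it would
   be a negative occurrence in the context.  The same remark bounds the size of a
   normal form by its derivation and, without tight constants, by its types.
   The type bound needs only that the final judgment, which reduction preserves,
   has no tight constant. *)
From mathcomp Require Import all_boot finmap multiset.
From mathcomp Require Import zify.
Require Import Defs.

Set Implicit Arguments.
Unset Strict Implicit.
Unset Printing Implicit Defensive.

Local Open Scope mset_scope.
Local Open Scope nat_scope.

(** * Terms: renumbering of indices, normal forms and progress *)

Lemma subst_Var k p n :
  subst k p (Var n) = if n == k then p else Var (unbump k n).
Proof. by rewrite /= /unbump; case: ltngtP => // _; rewrite ?subn0 ?subn1. Qed.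

Lemma lift_Var c n : lift c (Var n) = Var (bump c n).
Proof. by rewrite /= /bump; case: leqP. Qed.

Lemma normal_lo_App t u : normal_lo (App t u) -> neutral_lo t /\ normal_lo u.
Proof. by move=> H; inversion H; inversion H0. Qed.

Lemma normal_lo_Lam t : normal_lo (Lam t) -> normal_lo t.
Proof. by move=> H; inversion H; first inversion H0. Qed.

Lemma neutral_lo_abs t : neutral_lo t -> ~~ is_abstraction t.
Proof. by case. Qed.

Lemma normal_lo_step t p : normal_lo t -> ~ lo_step t p.
Proof.
move=> nt st; elim: st nt => {t p}.
- by move=> u q /normal_lo_App[/neutral_lo_abs].
- by move=> t p _ IH /normal_lo_Lam.
- by move=> t p u _ IH _ /normal_lo_App[/normal_lo_neutral].
- by move=> u t p _ _ IH /normal_lo_App[].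
Qed.

Lemma lo_progress t : normal_lo t \/ exists p, lo_step t p.
Proof.
elim: t => [n|t [nt|[p st]]|t [nt|[p st]] u IHu].
- by left; do 2 constructor.
- by left; constructor.
- by right; exists (Lam p); constructor.
- case: nt => {}t nt; last by right; eexists; constructor.
  case: IHu => [nu|[p st]]; first by left; do 2 constructor.
  by right; exists (App t p); constructor.
(* [lo_appl] is barred when [t] is an abstraction, but then the application is itself a redex. *)
- right; case: t st => [n|t|t1 t2] st; last by exists (App p u); constructor.
    by inversion st.
  by eexists; constructor.
Qed.

Section Typing.
Context {A : choiceType}.
Implicit Types (G D : ctx A) (s : ty A) (M : {mset ty A}) (L : seq (ty A)).

(** * Algebra of contexts *)

Lemma ctxP G D : (forall x, G x = D x) -> G = D.
Proof. by move=> e; apply/fsfunP. Qed.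

Lemma ctxUA : associative (@ctxU A).
Proof. by move=> G D E; apply: ctxP => x; rewrite !ctxUE msetDA. Qed.
Lemma ctxUC : commutative (@ctxU A).
Proof. by move=> G D; apply: ctxP => x; rewrite !ctxUE msetDC. Qed.
Lemma ctx0U : left_id ctx0 (@ctxU A).
Proof. by move=> G; apply: ctxP => x; rewrite ctxUE ctx0E mset0D. Qed.

Lemma ctxUACA : interchange (@ctxU A) (@ctxU A).
Proof. by move=> G D E F; rewrite -!ctxUA (ctxUA D) (ctxUC D) -(ctxUA E). Qed.

(** Weakening, the counterpart of [lift c]: index [c] is not in the image of [bump c], so its entry
    is the default [mset0]. *)
Definition ctx_lift c G : ctx A :=
  [fsfun x in [fset bump c y | y in finsupp G]%fset => G (unbump c x)].

Lemma ctx_liftE c G x :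
  ctx_lift c G x = if x == c then mset0 else G (unbump c x).
Proof.
rewrite fsfun_fun; have [->|xc] := eqVneq x c.
  by case: imfsetP => // -[y _ /eqP]; rewrite (negPf (neq_bump _ _)).
have [//|xG] := boolP (x \in _).
rewrite fsfun_dflt //; apply: contra xG => xG.
by apply/imfsetP; exists (unbump c x); rewrite ?unbumpK.
Qed.

(** Counterpart of [subst k]: the entry at [k] is forgotten, because the substituted term brings its
    own context in exchange. *)
Definition ctx_drop k G : ctx A :=
  [fsfun x in [fset unbump k y | y in finsupp G]%fset => G (bump k x)].

Lemma ctx_dropE k G x : ctx_drop k G x = G (bump k x).
Proof.
rewrite fsfun_fun; have [//|xG] := boolP (x \in _).
rewrite fsfun_dflt //; apply: contra xG => xG.
by apply/imfsetP; exists (bump k x); rewrite ?bumpK.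
Qed.

Lemma ctx_lift0 c : ctx_lift c ctx0 = ctx0.
Proof. by apply: ctxP => x; rewrite ctx_liftE !ctx0E if_same. Qed.
Lemma ctx_drop0 k : ctx_drop k ctx0 = ctx0.
Proof. by apply: ctxP => x; rewrite ctx_dropE !ctx0E. Qed.
Lemma ctx_liftU c G D : ctx_lift c (ctxU G D) = ctxU (ctx_lift c G) (ctx_lift c D).
Proof.
by apply: ctxP => x; rewrite ctxUE !ctx_liftE ctxUE; case: eqP; rewrite ?msetD0.
Qed.
Lemma ctx_dropU k G D : ctx_drop k (ctxU G D) = ctxU (ctx_drop k G) (ctx_drop k D).
Proof. by apply: ctxP => x; rewrite ctxUE !ctx_dropE ctxUE. Qed.

Lemma ctx_pop_lift c G : ctx_pop (ctx_lift c.+1 G) = ctx_lift c (ctx_pop G).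
Proof.
by apply: ctxP => x; rewrite ctx_popE !ctx_liftE eqSS unbumpS ctx_popE.
Qed.

Lemma ctx_pop_drop_lift k G D :
  ctx_pop (ctxU (ctx_drop k.+1 G) (ctx_lift 0 D)) = ctxU (ctx_drop k (ctx_pop G)) D.
Proof.
apply: ctxP => x; rewrite ctx_popE !ctxUE !ctx_dropE ctx_popE bumpS ctx_liftE.
by rewrite /= /unbump subn1.
Qed.

(** * Typability as a relation on terms *)

Definition jdg := ctx A -> nat -> nat -> ty A -> Prop.

(** Rule (many) on sequences, one premise at a time, which makes induction and inversion available;
    [many_perm] recovers independence of the order. *)
Inductive many (J : jdg) : ctx A -> nat -> nat -> seq (ty A) -> Prop :=
| many_nil : many J ctx0 0 0 [::]
| many_cons G D b b' r r' s L :
    J G b r s -> many J D b' r' L ->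
    many J (ctxU G D) (b + b') (r + r') (s :: L).

Inductive typ_var x : jdg :=
| typ_ax s : typ_var x (ctx1 x [mset s]) 0 0 s.

Inductive typ_lam (J : jdg) : jdg :=
| typ_fun_b G b r s :
    J G b r s -> typ_lam J (ctx_pop G) b.+1 r (Arr (G 0) s)
| typ_fun_r G b r c :
    J G b r (Tight c) -> mset_tight (G 0) ->
    typ_lam J (ctx_pop G) b r.+1 (Tight TAbs).

Inductive typ_app (J K : jdg) : jdg :=
| typ_app_b G D b b' r r' L s :
    J G b r (Arr (seq_mset L) s) -> many K D b' r' L ->
    typ_app J K (ctxU G D) (b + b').+1 (r + r') s
| typ_app_r G D b b' r r' c :
    J G b r (Tight TNeutral) -> K D b' r' (Tight c) ->
    typ_app J K (ctxU G D) (b + b') (r + r').+1 (Tight TNeutral).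

(* Typability, by recursion on the term: inversion is then computation, and
   the proofs below go by induction on terms instead of derivations. *)
Fixpoint typ (t : term) : jdg :=
  match t with
  | Var x => typ_var x
  | Lam u => typ_lam (typ u)
  | App u v => typ_app (typ u) (typ v)
  end.

Scheme der_mder_ind := Induction for der Sort Prop
  with mder_der_ind := Induction for mder Sort Prop.

Lemma many_big (J : jdg) (I : Type) (e : seq I) (D : I -> ctx A)
    (b r : I -> nat) (s : I -> ty A) :
  (forall i, J (D i) (b i) (r i) (s i)) ->
  many J (\big[ctxU/ctx0]_(i <- e) D i) (\sum_(i <- e) b i) (\sum_(i <- e) r i)
    (map s e).
Proof.
move=> JD; elim: e => [|i e IH]; rewrite ?big_nil ?big_cons; first exact: many_nil.
exact: many_cons.
Qed.

Lemma der_typ G b r t s : der G b r t s -> typ t G b r s.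
Proof.
move=> F; elim F using der_mder_ind with
  (P0 := fun G b r t M _ => exists2 L, M = seq_mset L & many (typ t) G b r L)
  => {G b r t s F} /=.
- by constructor.
- by move=> *; constructor.
- by move=> *; econstructor; eauto.
- move=> G D b b' r r' t p M s _ tt _ [L eM pL].
  by rewrite eM in tt; econstructor; eauto.
- by move=> *; econstructor; eauto.
- move=> n D b r t s _ Ft; exists [seq s i | i : 'I_n] => //.
  (* Unfolding makes the big operators and the sequence of types range over the same enumeration of
     ['I_n], as [many_big] requires. *)
  by rewrite [index_enum _]unlock /image_mem enumT; apply: many_big.
Qed.

(** Every counted rule adds one to exactly one of [b] and [r], while (ax) and (many) add nothing. *)
Lemma der_size_loE G b r t s (F : der G b r t s) : der_size_lo F = b + r.
Proof.
elim F using der_mder_ind with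
  (P0 := fun G b r t M (F : mder G b r t M) => mder_size_lo F = b + r)
  => {G b r t s F} /= *; try lia.
by rewrite -big_split; apply: eq_bigr.
Qed.

Lemma typ_lam_Arr J G b r M s :
  typ_lam J G b r (Arr M s) ->
  exists G' b', [/\ J G' b' r s, G = ctx_pop G', b = b'.+1 & M = G' 0].
Proof.
(* [Arr] is a function and not a constructor, so the index is generalized and inverted with
   [Arr_inj]. *)
move eq_t: (Arr M s) => u H; case: H eq_t => [G' b' r' s' H|] //.
by move=> /Arr_inj[-> ->]; exists G', b'.
Qed.

Lemma typ_lam_TNeutral J G b r : ~ typ_lam J G b r (Tight TNeutral).
Proof. by move eq_t: (Tight TNeutral) => u H; case: H eq_t. Qed.

Lemma many_nilE J G b r : many J G b r [::] -> [/\ G = ctx0, b = 0 & r = 0].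
Proof. by move=> H; inversion H. Qed.

Lemma many_consE J G b r s L : many J G b r (s :: L) ->
  exists G1 b1 r1 G2 b2 r2,
    [/\ J G1 b1 r1 s, many J G2 b2 r2 L, G = ctxU G1 G2, b = b1 + b2
      & r = r1 + r2].
Proof.
by move=> H; inversion H as [|G1 G2 b1 b2 r1 r2]; exists G1, b1, r1, G2, b2, r2.
Qed.

Lemma many_catE J G b r L1 L2 : many J G b r (L1 ++ L2) ->
  exists G1 b1 r1 G2 b2 r2,
    [/\ many J G1 b1 r1 L1, many J G2 b2 r2 L2, G = ctxU G1 G2, b = b1 + b2
      & r = r1 + r2].
Proof.
elim: L1 G b r => [|s L1 IH] G b r /=.
  move=> H; exists ctx0, 0, 0, G, b, r.
  by split=> //; [exact: many_nil | rewrite ctx0U].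
case/many_consE=> G1 [b1] [r1] [G0] [b0] [r0] [H1 /IH{IH}].
case=> G2 [b2] [r2] [G3] [b3] [r3] [H2 H3 -> -> ->] {G b r}-> -> ->.
exists (ctxU G1 G2), (b1 + b2), (r1 + r2), G3, b3, r3.
by split; rewrite ?ctxUA ?addnA //; apply: many_cons.
Qed.

Lemma many_rem J G b r s L : s \in L -> many J G b r L -> many J G b r (s :: rem s L).
Proof.
elim: L G b r => // s' L IH G b r; rewrite inE /=.
have [-> //|ss' /= sL] := eqVneq s s'.
case/many_consE=> G1 [b1] [r1] [G0] [b0] [r0] [H1 /(IH _ _ _ sL)].
case/many_consE=> G2 [b2] [r2] [G3] [b3] [r3] [H2 H3 -> -> ->] {G b r}-> -> ->.
rewrite ctxUA addnA addnA (ctxUC G1) (addnC b1) (addnC r1) -ctxUA -!addnA.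
by do 2 apply: many_cons => //.
Qed.

(** [ctxU] and [+] are commutative and associative, so any premise can be brought to the front
    ([many_rem]). *)
Lemma many_perm J G b r L L' : perm_eq L L' -> many J G b r L -> many J G b r L'.
Proof.
elim: L' L G b r => [|s L' IH] L G b r pL; first by rewrite (perm_nilP pL).
have sL : s \in L by rewrite (perm_mem pL) mem_head.
case/(many_rem sL)/many_consE=> G1 [b1] [r1] [G2] [b2] [r2] [H1 H2 -> -> ->].
apply: many_cons => //; apply: IH H2.
by rewrite -(perm_cons s) -(permPl (perm_to_rem sL)).
Qed.

Lemma perm_msetD M N : perm_eq (M `+` N) (M ++ N).
Proof.
rewrite -(permPr (perm_eq_seq_mset _)); apply/eq_seq_msetP.
rewrite !seq_mset_id; apply/msetP => x.
by rewrite mset_seqE count_cat msetE2 !count_mem_mset.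
Qed.

(** * Weakening and substitution *)

Lemma many_lift (J J' : jdg) c G b r L :
    (forall G b r s, J G b r s -> J' (ctx_lift c G) b r s) ->
  many J G b r L -> many J' (ctx_lift c G) b r L.
Proof.
move=> JJ'; elim=> [|{}G D {}b b' {}r r' s {}L /JJ' H _ IH].
  by rewrite ctx_lift0; apply: many_nil.
by rewrite ctx_liftU; apply: many_cons.
Qed.

Lemma typ_lift t c G b r s : typ t G b r s -> typ (lift c t) (ctx_lift c G) b r s.
Proof.
elim: t c G b r s => [n|t IH|t IHt u IHu] c G b r s.
- rewrite lift_Var => -[{}s]; suff -> : ctx_lift c (ctx1 n [mset s])
    = ctx1 (bump c n) [mset s] by constructor.
  apply: ctxP => x; rewrite ctx_liftE !ctx1E.
  have [->|xc] := eqVneq x c; first by rewrite (negPf (neq_bump _ _)).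
  by rewrite -(can_eq (bumpK c)) unbumpK.
- rewrite /=; case=> [{}G {}b {}r {}s|{}G {}b {}r c'] /(IH c.+1) H.
    rewrite -ctx_pop_lift; suff -> : G 0 = ctx_lift c.+1 G 0 by constructor.
    by rewrite ctx_liftE.
  move=> G0; rewrite -ctx_pop_lift; econstructor; first exact: H.
  by rewrite ctx_liftE.
- rewrite /=; case=> [{}G D {}b b' {}r r' L {}s|{}G D {}b b' {}r r' c'];
    move=> /(IHt c) Ht Hu; rewrite ctx_liftU.
    econstructor; first exact: Ht.
    by apply: many_lift Hu => *; apply: IHu.
  by econstructor; [exact: Ht | exact: IHu Hu].
Qed.

(** The derivations for [G k] are shared out among the premises along the decomposition of [G]. The
    judgments are abstract so that the induction hypothesis of [typ_subst] on an argument can serve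
    as [JJ']. *)
Lemma many_subst (J J' K : jdg) k G b r L D b' r' :
    (forall G b r s D b' r', J G b r s -> many K D b' r' (enum_mset (G k)) ->
      J' (ctxU (ctx_drop k G) D) (b + b') (r + r') s) ->
  many J G b r L -> many K D b' r' (enum_mset (G k)) ->
  many J' (ctxU (ctx_drop k G) D) (b + b') (r + r') L.
Proof.
move=> JJ' H; elim: H D b' r' => {G b r L}.
  move=> D b' r'; rewrite ctx0E enum_mset0 => /many_nilE[-> -> ->].
  by rewrite ctx_drop0 ctx0U; apply: many_nil.
move=> G1 G2 b1 b2 r1 r2 s L H1 _ IH D b' r'; rewrite ctxUE.
case/(many_perm (perm_msetD _ _))/many_catE.
move=> D1 [b1'] [r1'] [D2] [b2'] [r2'] [K1 K2 -> -> ->].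
rewrite ctx_dropU ctxUACA (addnACA b1) (addnACA r1).
by apply: many_cons; [apply: JJ' | apply: IH].
Qed.
(** Each axiom for the variable [k] is replaced by one derivation of [p]; axioms have indices
    [(0,0)], so the indices add up exactly. *)
Lemma typ_subst t k p G b r s D b' r' :
  typ t G b r s -> many (typ p) D b' r' (enum_mset (G k)) ->
  typ (subst k p t) (ctxU (ctx_drop k G) D) (b + b') (r + r') s.
Proof.
elim: t k p G b r s D b' r' => [n|t IH|t IHt u IHu] k p G b r s D b' r'.
- rewrite subst_Var => -[{}s]; rewrite ctx1E eq_sym; case: (eqVneq n k) => [-> | nk].
    rewrite enum_msetn => /many_consE[G1 [b1] [r1] [G2] [b2] [r2] [Hp]].
    case/many_nilE=> -> -> -> -> -> ->; rewrite !addn0.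
    suff -> : ctxU (ctx_drop k (ctx1 k [mset s])) (ctxU G1 ctx0) = G1 by [].
    apply: ctxP => x; rewrite !ctxUE ctx_dropE ctx1E ctx0E msetD0.
    by rewrite eq_sym (negPf (neq_bump _ _)) mset0D.
  rewrite enum_mset0 => /many_nilE[-> -> ->]; rewrite ctxUC ctx0U.
  suff -> : ctx_drop k (ctx1 n [mset s]) = ctx1 (unbump k n) [mset s] by constructor.
  apply: ctxP => x; rewrite ctx_dropE !ctx1E -[in bump k x == n](unbumpK nk).
  by rewrite (can_eq (bumpK k)).
(* Under the binder [p] and its contexts are lifted; their entry 0 is then empty, so the multiset of
   the bound variable is unchanged. *)
- rewrite /=; case=> [{}G {}b {}r {}s|{}G {}b {}r c] Ht; [|move=> G0];
    rewrite ctx_popE => /(many_lift (@typ_lift p 0)) Hp.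
    rewrite -ctx_pop_drop_lift; have := IH _ _ _ _ _ _ _ _ _ Ht Hp.
    move/(typ_fun_b (J := typ _)).
    by rewrite ctxUE ctx_dropE ctx_liftE msetD0.
  rewrite -ctx_pop_drop_lift; econstructor; first exact: IH Ht Hp.
  by rewrite ctxUE ctx_dropE ctx_liftE msetD0.
- rewrite /=; case=> [{}G1 G2 {}b1 b2 {}r1 r2 L {}s|{}G1 G2 {}b1 b2 {}r1 r2 c'] Ht Hu;
    rewrite ctxUE => /(many_perm (perm_msetD _ _))/many_catE;
    move=> [D1] [b1'] [r1'] [D2] [b2'] [r2'] [K1 K2 -> -> ->];
    rewrite ctx_dropU ctxUACA !addSn (addnACA b1) (addnACA r1).
    econstructor; first exact: IHt Ht K1.
    by apply: many_subst Hu K2 => *; apply: IHu.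
  by econstructor; [exact: IHt Ht K1 | exact: IHu Hu K2].
Qed.

(** * Occurrences in contexts and in types of neutral terms *)

Implicit Types (T : ty A + {mset ty A}) (pol : polarity).

(** Only elements of the entries are inspected, not the entries as multisets, so that the condition
    splits along [ctxU] for both polarities. *)
Definition ctx_avoids T pol G := forall x u, u \in enum_mset (G x) -> ~ occ_ty T pol u.

Lemma ctx_avoids_occ T pol G : ~ occ_ctx T pol G -> ctx_avoids T pol G.
Proof. by move=> nG x u uG oT; apply: nG; exists x; apply: occ_mset_elt oT. Qed.

Lemma ctx_avoidsU T pol G D :
  ctx_avoids T pol (ctxU G D) <-> ctx_avoids T pol G /\ ctx_avoids T pol D.
Proof.
split=> [GD|[aG aD] x u]; first by split=> x u uG; apply: (GD x);
  rewrite ctxUE (perm_mem (perm_msetD _ _)) mem_cat uG ?orbT.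
by rewrite ctxUE (perm_mem (perm_msetD _ _)) mem_cat => /orP[/aG|/aD].
Qed.

Lemma ctx_avoids_pop T pol G :
  (forall u, u \in enum_mset (G 0) -> ~ occ_ty T pol u) ->
  ctx_avoids T pol (ctx_pop G) -> ctx_avoids T pol G.
Proof. by move=> G0 aG [//|x] u uG; apply: (aG x); rewrite ctx_popE. Qed.

Lemma occ_ty_Tight M pol c : ~ occ_ty (inr M) pol (Tight c).
Proof. by move eq_s: (Tight c) => s o; case: o eq_s => // ? ->. Qed.

Lemma mset_tight_avoids M pol G :
  mset_tight (G 0) -> forall u, u \in enum_mset (G 0) -> ~ occ_ty (inr M) pol u.
Proof. by move=> /allP tG u /tG/is_tightP[c ->]; apply: occ_ty_Tight. Qed.

Lemma avoids_source T pol M s u :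
  ~ occ_ty T pol (Arr M s) -> u \in enum_mset M -> ~ occ_ty T (opp pol) u.
Proof. by move=> nM uM oT; apply/nM/occ_ty_source/occ_mset_elt/oT. Qed.

Lemma avoids_target T pol M s : ~ occ_ty T pol (Arr M s) -> ~ occ_ty T pol s.
Proof. by move=> nM oT; apply/nM/occ_ty_target. Qed.

(** A multiset occurs positively in itself, hence negatively in an arrow of which it is the
    source. *)
Lemma avoids_mset0_source L s :
  ~ occ_ty (inr mset0) Neg (Arr (seq_mset L) s) -> L <> [::].
Proof.
move=> nM L0; apply/nM/occ_ty_source/occ_mset_self; congr inr.
by rewrite L0; apply/msetP => x; rewrite mset_seqE mset0E.
Qed.

(** The witness is the type in the axiom of the head variable: [typ_app_b] passes to a target, which
    preserves polarity, and [typ_app_r] keeps the type. *)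
Lemma neutral_typ_occ t G b r s :
  neutral_lo t -> typ t G b r s ->
  exists x u, u \in enum_mset (G x) /\ forall T pol, occ_ty T pol s -> occ_ty T pol u.
Proof.
elim: t G b r s => [n|t _|t IHt p _] G b r s nt.
- by case=> {}s; exists n, s; rewrite ctx1E eqxx enum_msetn mem_head.
- by inversion nt.
have {}nt : neutral_lo t by inversion nt.
by case=> [{}G D {}b b' {}r r' L {}s|{}G D {}b b' {}r r' c] /(IHt _ _ _ _ nt)
  [x [u [uG occ_u]]] _; exists x, u; rewrite ctxUE (perm_mem (perm_msetD _ _));
  rewrite mem_cat uG; split=> // T pol oT; apply: occ_u => //; apply: occ_ty_target.
Qed.

Lemma neutral_typ_avoids t G b r s T pol :
  neutral_lo t -> typ t G b r s -> ctx_avoids T pol G -> ~ occ_ty T pol s.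
Proof.
by move=> nt /(neutral_typ_occ nt)[x [u [uG occ_u]]] aG /occ_u; apply: (aG x).
Qed.

(** * Quantitative subject reduction and normalization *)

Lemma many_shrink J J' T pol G b r L :
    (forall G b r s, J G b r s -> ctx_avoids T pol G -> s \in L ->
      exists2 b', J' G b' r s & b' + 2 <= b) ->
    ctx_avoids T pol G -> L <> [::] -> many J G b r L ->
  exists2 b', many J' G b' r L & b' + 2 <= b.
Proof.
move=> JJ' aG L0.
(* Non-emptiness is not inherited by tails, so the induction proves a loss of 2 for each element of
   [L]. *)
suff H : many J G b r L -> exists2 b', many J' G b' r L & b' + 2 * size L <= b.
  by move=> /H[b' H' leb]; exists b' => //; case: L L0 leb {H H' JJ'} => //= s L _; lia.
move=> H; elim: H JJ' aG {L0} => {G b r L} [|G D b b' r r' s L H _ IH] JJ'.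
  by exists 0 => //; apply: many_nil.
case/ctx_avoidsU=> aG aD.
have [b1 H1 le1] := JJ' _ _ _ _ H aG (mem_head _ _).
have [|b2 H2 le2] := IH _ aD.
  by move=> *; apply: JJ' => //; rewrite inE orbC; apply/orP; left.
by exists (b1 + b2) => /=; [apply: many_cons | lia].
Qed.

(** The condition on [s] is guarded by [is_abstraction] for the sake of [lo_appl]: nothing is known
    there about the source of the type of the function, but the function is not an abstraction. *)
Lemma lo_step_typ t p G b r s :
    lo_step t p -> typ t G b r s -> ctx_avoids (inr mset0) Neg G ->
    (is_abstraction t -> ~ occ_ty (inr mset0) Pos s) ->
  exists2 b', typ p G b' r s & b' + 2 <= b.
Proof.
move=> st; elim: st G b r s => {t p} [u q|t p st IH|t p u st IH nabs|u t p nu st IH] G b r s.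
- case=> [{}G D {}b b' {}r r' L {}s|{}G D {}b b' {}r r' c].
    (* The drop of 2 comes from here: the abstraction and application rules of the redex
       disappear. *)
    case/typ_lam_Arr=> G' [b1] [Hu -> -> eL] Hq _ _; exists (b1 + b'); last by lia.
    have /many_perm/(_ Hq) {}Hq : perm_eq L (enum_mset (G' 0)).
      by rewrite -eL perm_sym perm_eq_seq_mset.
    suff -> : ctx_pop G' = ctx_drop 0 G' by apply: typ_subst.
    by apply: ctxP => x; rewrite ctx_popE ctx_dropE.
  by move=> /typ_lam_TNeutral.
- case=> [{}G {}b {}r {}s|{}G {}b {}r c] Ht.
    move=> aG /(_ isT) ns.
    have [|_|b' H' leb] := IH _ _ _ _ Ht.
    (* [G 0] is the source of the arrow type, so a negative occurrence in one of its elements would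
       be positive in that type. *)
    + by apply: ctx_avoids_pop aG => v; apply: (avoids_source ns).
    + exact: avoids_target ns.
    + by exists b'.+1; [constructor | lia].
  move=> G0 aG _; have [||b' H' leb] := IH _ _ _ _ Ht.
  + by apply: ctx_avoids_pop aG; apply: mset_tight_avoids.
  + by move=> _; apply: occ_ty_Tight.
  + by exists b' => //; apply: typ_fun_r H' _.
- case=> [{}G D {}b b' {}r r' L {}s|{}G D {}b b' {}r r' c] Ht Hu /ctx_avoidsU[aG _] _;
    (have [|b1 H1 leb] := IH _ _ _ _ Ht aG; first by rewrite (negPf nabs)).
    by exists (b1 + b').+1; [apply: typ_app_b H1 Hu | lia].
  by exists (b1 + b'); [apply: typ_app_r H1 Hu | lia].
- case=> [{}G D {}b b' {}r r' L {}s|{}G D {}b b' {}r r' c] Hu Ht /ctx_avoidsU[aG aD] _.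
    (* [na] serves twice: the source [L] is not empty, and its elements satisfy the positive
       condition that the induction hypothesis asks for. *)
    have na := neutral_typ_avoids nu Hu aG.
    have [||b1 H1 leb] := many_shrink (J' := typ p) _ aD _ Ht.
    + move=> {Ht} D' b1 r1 s' Ht aD' sL; apply: (IH _ _ _ _ Ht aD') => _.
      by apply: (avoids_source na); rewrite (perm_mem (perm_eq_seq_mset _)).
    + exact: avoids_mset0_source na.
    by exists (b + b1).+1; [apply: typ_app_b Hu H1 | lia].
  have [|b1 H1 leb] := IH _ _ _ _ Ht aD; first by move=> _; apply: occ_ty_Tight.
  by exists (b + b1); [apply: typ_app_r Hu H1 | lia].
Qed.

(** Strong induction on [b], which every step decreases; a step changes neither the context nor the
    type, so both conditions persist. *)
Lemma lo_normalization t G b r s :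
    typ t G b r s -> ctx_avoids (inr mset0) Neg G -> ~ occ_ty (inr mset0) Pos s ->
  exists p k b', [/\ normal_lo p, lo_steps k t p, typ p G b' r s & b' + 2 * k <= b].
Proof.
move=> Ht aG ns; have [n] := ubnP b; elim: n => // n IH in t b Ht *.
case: (lo_progress t) => [nt|[u st]] ltb; first by exists t, 0, b; split; rewrite ?addn0.
have [b1 Hu leb] := lo_step_typ st Ht aG (fun=> ns).
have [|p [k [b' [np sp Hp leb']]]] := IH _ _ Hu; first by lia.
by exists p, k.+1, b'; split=> //=; [exists u | lia].
Qed.

(** * Size of a normal form against its indices *)

Lemma normal_typ_size t G b r s :
    normal_lo t -> typ t G b r s -> ctx_avoids (inr mset0) Neg G ->
    (is_abstraction t -> ~ occ_ty (inr mset0) Pos s) ->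
  term_size t <= b + r.
Proof.
elim: t G b r s => [//|t IH|t IHt u IHu] G b r s.
- move=> /normal_lo_Lam nt /=; case=> [{}G {}b {}r {}s|{}G {}b {}r c] Ht.
    move=> aG /(_ isT) ns; rewrite addSn ltnS; apply: IH nt Ht _ _.
      by apply: ctx_avoids_pop aG => v; apply: (avoids_source ns).
    by move=> _; apply: avoids_target ns.
  move=> G0 aG _; rewrite addnS ltnS; apply: IH nt Ht _ _.
    by apply: ctx_avoids_pop aG; apply: mset_tight_avoids.
  by move=> _; apply: occ_ty_Tight.
move=> /normal_lo_App[nt nu] /=.
case=> [{}G D {}b b' {}r r' L {}s|{}G D {}b b' {}r r' c] Ht Hu /ctx_avoidsU[aG aD] _;
  (have leb : term_size t <= b + r by
     apply: IHt (normal_lo_neutral nt) Ht aG _; rewrite (negPf (neutral_lo_abs nt))).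
  have na := neutral_typ_avoids nt Ht aG.
  (* The argument has at least one derivation, and the first one already pays for [u]. *)
  case: L Ht Hu na => [_ _ /avoids_mset0_source//|s' L] Ht.
  case/many_consE=> D1 [b1] [r1] [D2] [b2] [r2] [Hu _ eD -> ->] na.
  move: aD; rewrite eD => /ctx_avoidsU[aD _].
  suff : term_size u <= b1 + r1 by lia.
  apply: IHu nu Hu aD _ => _; apply: (avoids_source na).
  by rewrite (perm_mem (perm_eq_seq_mset _)) mem_head.
suff : term_size u <= b' + r' by lia.
by apply: IHu nu Hu aD _ => _; apply: occ_ty_Tight.
Qed.

(** * Sizes of types and contexts, and the bound by types *)

Lemma mset_sizeE L : mset_size (seq_mset L) = \sum_(u <- L) ty_size u.
Proof. by rewrite /mset_size (perm_big _ (perm_eq_seq_mset L)). Qed.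

Lemma mset_sizeD M N : mset_size (M `+` N) = mset_size M + mset_size N.
Proof. by rewrite /mset_size (perm_big _ (perm_msetD M N)) big_cat. Qed.

Lemma mset_size0 : mset_size (mset0 : {mset ty A}) = 0.
Proof. by rewrite /mset_size enum_mset0 big_nil. Qed.

(** Contexts with different supports become comparable by summing over a common initial segment of
    indices. *)
Lemma ctx_sizeE n G : (forall x, x \in finsupp G -> x < n) ->
  ctx_size G = \sum_(0 <= x < n) mset_size (G x).
Proof.
move=> Gn; rewrite (bigID (mem (finsupp G))) /= [X in _ + X]big1 ?addn0 => [|x xG].
  rewrite -big_filter; apply/perm_big/uniq_perm.
  - exact: fset_uniq.
  - by rewrite filter_uniq ?iota_uniq.
  - by move=> x; rewrite mem_filter mem_index_iota /=; case: (boolP (x \in _)) => //= xG; rewrite Gn.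
by rewrite fsfun_dflt ?mset_size0.
Qed.

Lemma ctx_bounded G : exists n, forall x, x \in finsupp G -> x < n.
Proof.
exists (\max_(x <- finsupp G) x.+1) => x xG.
exact: (leq_bigmax_seq (F := S)).
Qed.

Lemma ctx_sizeU G D : ctx_size (ctxU G D) = ctx_size G + ctx_size D.
Proof.
have [[m mG] [n nD]] := (ctx_bounded G, ctx_bounded D).
have [k kGD] := ctx_bounded (ctxU G D).
rewrite !(@ctx_sizeE (m + n + k)) => [|x /nD|x /mG|x /kGD]; try lia.
by rewrite -big_split; apply: eq_bigr => x _; rewrite ctxUE mset_sizeD.
Qed.

Lemma ctx_size_pop G : ctx_size G = mset_size (G 0) + ctx_size (ctx_pop G).
Proof.
have [[m mG] [n nG]] := (ctx_bounded G, ctx_bounded (ctx_pop G)).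
rewrite (@ctx_sizeE (m + n).+1) => [|x /mG]; last by lia.
rewrite (@ctx_sizeE (m + n)) => [|x /nG]; last by lia.
by rewrite big_nat_recl //; congr addn; apply: eq_bigr => x _; rewrite ctx_popE.
Qed.

Lemma ctx_size1 x s : ctx_size (ctx1 x [mset s]) = ty_size s.
Proof.
have [n xn] := ctx_bounded (ctx1 x [mset s]); rewrite (@ctx_sizeE (n + x.+1)).
  rewrite (bigD1_seq x) ?iota_uniq ?mem_index_iota //=; last by lia.
  rewrite big1 => [|y /negPf yx]; last by rewrite ctx1E yx mset_size0.
  by rewrite ctx1E eqxx /mset_size enum_msetn big_seq1 addn0.
by move=> y /xn; lia.
Qed.

(** The type of a neutral term is a target of its head variable's type, so the context pays for it
    and it stands on the left; each application spends one arrow, whose source helps to pay for the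
    argument. The type of an abstraction collects what leaves the context, so it stands on the
    right. *)
Lemma normal_typ_size_ty t G b r s :
    normal_lo t -> typ t G b r s ->
    ctx_avoids (inr mset0) Neg G -> (forall c pol, ctx_avoids (inl (Tight c)) pol G) ->
  (neutral_lo t -> term_size t + ty_size s <= ctx_size G) /\
  (~ occ_ty (inr mset0) Pos s -> (forall c pol, ~ occ_ty (inl (Tight c)) pol s) ->
   term_size t <= ctx_size G + ty_size s).
Proof.
elim: t G b r s => [n|t IH|t IHt u IHu] G b r s.
- move=> _ /=; case=> {}s _ _; rewrite ctx_size1; lia.
- move=> /normal_lo_Lam nt H aG tG; split; first by move=> nl; inversion nl.
  move: H aG tG => /=; case=> [{}G {}b {}r {}s Ht aG tG ns ts|{}G {}b {}r c _ _ _ _ _ ts].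
    have [|c pol|_ le_t] := IH _ _ _ _ nt Ht.
    + by apply: ctx_avoids_pop aG => v; apply: (avoids_source ns).
    + apply: ctx_avoids_pop (tG c pol) => v vG.
      have := @avoids_source _ (opp pol) _ _ _ (ts c (opp pol)) vG.
      by case: pol.
    + rewrite ty_size_arr; have := ctx_size_pop G.
      suff : term_size t <= ctx_size G + ty_size s by lia.
      apply: le_t; first exact: avoids_target ns.
      by move=> c pol; apply: avoids_target (ts c pol).
  (* [typ_fun_r] is excluded, since it assigns a tight constant. *)
  by case: (ts TAbs Pos); apply: occ_ty_self.
move=> /normal_lo_App[nt nu] H aG tG.
suff le_tu : term_size (App t u) + ty_size s <= ctx_size G by split=> //; lia.
move: H aG tG => /=.
case=> [{}G D {}b b' {}r r' L {}s|{}G D {}b b' {}r r' c] Ht Hu /ctx_avoidsU[aG aD] tGD;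
  (have tG : forall c pol, ctx_avoids (inl (Tight c)) pol G by
     move=> c0 pol; have /ctx_avoidsU[] := tGD c0 pol); last first.
  (* [typ_app_r] is excluded: the constant [TNeutral] would occur in the context. *)
  by case: (neutral_typ_avoids nt Ht (tG TNeutral Pos)); apply: occ_ty_self.
have [/(_ nt) le_t _] := IHt _ _ _ _ (normal_lo_neutral nt) Ht aG tG.
have na := neutral_typ_avoids nt Ht aG.
have ta c pol := neutral_typ_avoids nt Ht (tG c pol).
move: le_t; rewrite ty_size_arr mset_sizeE ctx_sizeU.
case: L Ht Hu na ta => [_ _ /avoids_mset0_source//|s' L] _.
case/many_consE=> D1 [b1] [r1] [D2] [b2] [r2] [Hu _ eD _ _] na ta.
have s'L : s' \in enum_mset (seq_mset (s' :: L)).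
  by rewrite (perm_mem (perm_eq_seq_mset _)) mem_head.
have [|c pol|_ le_u] := IHu _ _ _ _ nu Hu.
- by move: aD; rewrite eD => /ctx_avoidsU[].
- by have := tGD c pol; rewrite eD => /ctx_avoidsU[_ /ctx_avoidsU[]].
rewrite big_cons eD ctx_sizeU => le_t.
(* In [le_t] the successor from the arrow pays for the application node, and [ty_size s'] for the
   type in the bound on [u]. *)
suff : term_size u <= ctx_size D1 + ty_size s' by lia.
apply: le_u; first exact: avoids_source na s'L.
by move=> c pol; have := avoids_source (ta c (opp pol)) s'L; case: pol.
Qed.

End Typing.

Theorem theorem7p8 (A : choiceType) (A_nonempty : inhabited A)
    (G : ctx A) (b r : nat) (t : term) (s : ty A) (Phi : der G b r t s)
    (Phi_shrinking : shrinking Phi) :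
  exists p k,
    lo_normal_form p /\
    2 * k <= b /\
    lo_steps k t p /\
    term_size p + 2 * k <= der_size_lo Phi /\
    (traditional Phi -> term_size p <= der_size_ty Phi).
Proof.
case: Phi_shrinking => nG ns; have aG := ctx_avoids_occ nG.
have [p [k [b' [np tp Hp leb]]]] := lo_normalization (der_typ Phi) aG ns.
exists p, k; split; first by move=> q; apply: normal_lo_step.
split; first by lia.
split=> //; split.
  rewrite der_size_loE.
  have := normal_typ_size np Hp aG (fun=> ns); lia.
(* [Hp] types [p] with the same [G] and [s] as [Phi], so tight-freeness of the final judgment
   carries over to the normal form. *)
move=> tPhi; have tf : tight_free G s by case: Phi tPhi {nG ns aG Hp leb tp} => /= *; tauto.
have [|_] := normal_typ_size_ty np Hp aG.
  by move=> c pol; apply: ctx_avoids_occ; have [] := tf c pol.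
by apply=> // c pol; have [] := tf c pol.
Qed.
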